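(* The sub-problem, i.e. the single-user Markov decision process described in the context, in which the arrivals are i.i.d. Bernoulli with $P[\Lambda(t)=1]=p$ (where $p>0$; $p=1$ is allowed), is indexable.
   Context: Sub-problem: a single-user Markov decision process with updating cost $C\in\mathbb{R}$, in discrete time $t=0,1,2,\dots$. States: $\mathbf{s}(t)=(X(t),\Lambda(t))$ with age $X(t)\in\{1,2,\dots\}$ and arrival indicator $\Lambda(t)\in\{0,1\}$. Actions: $a(t)\in\{0,1\}$, where $1$ means ''update'' and $0$ means ''idle''; both actions are available in every state. Transitions: from state $(x,\lambda)$ under action $a$, the next age is $1$ if $a=\lambda=1$ and is $x+1$ otherwise; independently of the past, the next arrival indicator is $1$ with probability $p$ and $0$ with probability $1-p$. Immediate cost: $C\bigl((x,\lambda),a\bigr)=(x+1-x\,a\,\lambda)+C\,a$. Policies: a policy $\mu=\{a(0),a(1),\dots\}$ specifies an action for each slot; it may be history dependent and randomized. The objective is to minimize, over policies, the average cost $\limsup_{T\to\infty}\frac{1}{T+1}E_\mu\left[\sum_{t=0}^{T}C(\mathbf{s}(t),a(t))\right]$. Optimal action: the optimal action in a state is the one that is preferable for minimizing the average cost; a tie between the two actions is broken in favor of idling. This is understood as follows. In a state $(x,0)$ both actions lead to the same next age and the same law of the next arrival indicator, so the optimal action is the one with the smaller immediate cost. In states $(x,1)$ the optimal actions are of threshold type: the optimal action in $(x,1)$ is to update if $x\ge\bar X^*$ and to idle if $x<\bar X^*$, where $\bar X^*\in\{1,2,\dots\}$ is the threshold minimizing the average cost (the larger one in case of a tie) among the policies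 that, for some $\bar X\in\{1,2,\dots\}$, update in $(x,1)$ exactly when $x\ge\bar X$ and idle in all states $(x,0)$ (the actions in states $(x,0)$ do not influence the evolution of the state, so fixing them does not affect this comparison). For $C\ge0$ the resulting threshold-type policy minimizes the average cost among all policies. Indexability: given the cost $C$, let $\mathbf{S}(C)$ be the set of states $\mathbf{s}$ such that the optimal action for $\mathbf{s}$ is to idle. The sub-problem is indexable if the set $\mathbf{S}(C)$ monotonically increases from the empty set to the entire state space as $C$ increases from $-\infty$ to $\infty$. *)

(* Defs.v *)
From mathcomp Require Import all_boot all_order all_algebra.
From mathcomp Require Import all_classical all_reals all_analysis.

Set Implicit Arguments.
Unset Strict Implicit.
Unset Printing Implicit Defensive.

Import Order.TTheory GRing.Theory Num.Theory.

Local Open Scope classical_set_scope.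
Local Open Scope ring_scope.

(* The pair (x, l) is the state with age x and arrival indicator l. Ages are
   positive, so the state space is [state_space] and not the whole type. *)
Definition state : Type := (nat * bool)%type.

Definition state_space : set state := [set s | (0 < s.1)%N].

Definition action : Type := bool.
Definition update : action := true.
Definition idle : action := false.

Definition next_age (s : state) (a : action) : nat :=
  if a && s.2 then 1%N else s.1.+1.

Definition cost (R : realType) (C : R) (s : state) (a : action) : R :=
  (s.1%:R + 1 - s.1%:R * a%:R * (s.2)%:R) + C * a%:R.

(* The past of a slot lists the earlier states and actions, oldest first. *)
Definition past : Type := seq (state * action).

Record policy (R : realType) := Policy {
  update_prob :> past -> state -> R ;
  update_prob01 : forall h s, 0 <= update_prob h s <= 1 }.

(* The randomness of n slots is recorded by the n pairs (action taken in the
   slot, arrival indicator of the next slot). The next two functions give the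
   probability of such a record under [mu] and the cost accumulated along it,
   when the process is in state [s] after the past [h]. *)
Fixpoint trajectory_prob (R : realType) (p : R) (mu : policy R)
    (h : past) (s : state) (w : seq (action * bool)) : R :=
  if w is (a, l) :: w' then
    bernoulli_pmf (mu h s) a * bernoulli_pmf p l *
    trajectory_prob p mu (rcons h (s, a)) (next_age s a, l) w'
  else 1.

Fixpoint trajectory_cost (R : realType) (C : R)
    (s : state) (w : seq (action * bool)) : R :=
  if w is (a, l) :: w' then
    cost C s a + trajectory_cost C (next_age s a, l) w'
  else 0.

(* The expectation of the sum of the costs of the slots 0, ..., T. *)
Definition expected_total_cost (R : realType) (p C : R) (mu : policy R)
    (s0 : state) (T : nat) : R :=
  \sum_(w : T.+1.-tuple (action * bool)%type)
    trajectory_prob p mu [::] s0 w * trajectory_cost C s0 w.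

Definition average_cost (R : realType) (p C : R) (mu : policy R)
    (s0 : state) : \bar R :=
  limn_esup (fun T => (T.+1%:R^-1 * expected_total_cost p C mu s0 T)%:E).

Definition threshold_update_prob (R : realType) (X : nat)
    (h : past) (s : state) : R := (s.2 && (X <= s.1)%N)%:R.

Lemma threshold_update_prob01 (R : realType) (X : nat) (h : past) (s : state) :
  0 <= threshold_update_prob R X h s <= 1.
Proof. by rewrite /threshold_update_prob ler0n lern1 leq_b1. Qed.

Definition threshold_policy (R : realType) (X : nat) : policy R :=
  Policy (threshold_update_prob01 R X).

Definition minimizing_threshold (R : realType) (p C : R) (s0 : state)
    (X : nat) : Prop :=
  (0 < X)%N /\ forall Y : nat, (0 < Y)%N ->
    (average_cost p C (threshold_policy R X) s0 <=
     average_cost p C (threshold_policy R Y) s0)%E.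

Definition is_optimal_threshold (R : realType) (p C : R) (s0 : state)
    (X : nat) : Prop :=
  minimizing_threshold p C s0 X /\
  forall Y : nat, minimizing_threshold p C s0 Y -> (Y <= X)%N.

(* Such a threshold is unique. The value 1 is a dummy, used only if there is
   none. *)
Definition optimal_threshold (R : realType) (p C : R) (s0 : state) : nat :=
  xget 1%N [set X | is_optimal_threshold p C s0 X].

Definition optimal_action (R : realType) (p C : R) (s0 s : state) : action :=
  if s.2 then
    if (optimal_threshold p C s0 <= s.1)%N then update else idle
  else
    if cost C s update < cost C s idle then update else idle.

Definition idle_set (R : realType) (p : R) (s0 : state) (C : R) : set state :=
  [set s | state_space s /\ optimal_action p C s0 s = idle].

(* For a nondecreasing family of sets, the limits at -oo and +oo are the
   intersection and the union of the family. *)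
Definition indexable (R : realType) (S : R -> set state) : Prop :=
  [/\ forall C D : R, C <= D -> S C `<=` S D,
      \bigcap_(C in [set: R]) S C = set0 &
      \bigcup_(C in [set: R]) S C = state_space].

(* Main.v *)
(* Under the threshold policy [X] the cost up to time [n] from a state of age [x]
   is [n g + H x] up to a bounded error, where [(g, H)] solves the Poisson equation.
   With [u X = X - 1 + 1/p] (the mean time between updates) this gives the average cost
   [g = (u X + 1) / 2 + (C + (1 - p) / (2 p^2)) / u X].  For [X < Y], the threshold
   [Y] is at least as good as [X] iff [u X * u Y <= 2 C + (1 - p) / p^2], so the optimal
   threshold is the least [X] with [2 C + (1 - p) / p^2 < u X * u X.+1], and idling is
   optimal in [(x, 1)] iff [u x * u x.+1 <= 2 C + (1 - p) / p^2], a condition which is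
   monotone in [C]. *)
Require Import Defs.
From mathcomp Require Import all_boot all_order all_algebra.
From mathcomp Require Import all_classical all_reals all_analysis.
From mathcomp Require Import ring lra.

Set Implicit Arguments.
Unset Strict Implicit.
Unset Printing Implicit Defensive.

Import Order.TTheory GRing.Theory Num.Theory.
Import numFieldNormedType.Exports.

Local Open Scope ring_scope.

(** * Sums over finite records of the randomness *)

Lemma big_tupleS (V : nmodType) (T : finType) {n} (F : seq T -> V) :
  \sum_(w : n.+1.-tuple T) F w = \sum_(x : T) \sum_(w : n.-tuple T) F (x :: w).
Proof.
rewrite pair_big /= (reindex (fun q : T * n.-tuple T => [tuple of q.1 :: q.2])) //=.
exists (fun w : n.+1.-tuple T => (thead w, [tuple of behead w])) => [[x w] _|w _].
- by congr pair; apply: val_inj.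
- by rewrite -tuple_eta.
Qed.

Lemma bernoulli_pmf_sum (R : realType) (q : R) (f : bool -> R) :
  \sum_(a : bool) bernoulli_pmf q a * f a = q * f true + (1 - q) * f false.
Proof. by rewrite big_bool. Qed.

Lemma trajectory_prob_sum (R : realType) (p : R) (mu : policy R) n h s :
  \sum_(w : n.-tuple (action * bool)%type) trajectory_prob p mu h s w = 1.
Proof.
elim: n h s => [|n IHn] h s.
  by rewrite (big_pred1 [tuple]) // => w; apply/esym/eqP; exact: tuple0.
rewrite (big_tupleS (trajectory_prob p mu h s)).
rewrite (eq_bigr (fun al : action * bool =>
    bernoulli_pmf (mu h s) al.1 * bernoulli_pmf p al.2)); last first.
  by case=> a l _ /=; rewrite -mulr_sumr IHn mulr1.
rewrite -(pair_big xpredT xpredT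
  (fun a l : bool => bernoulli_pmf (mu h s) a * bernoulli_pmf p l)) /=.
rewrite !big_bool /=; ring.
Qed.

(** * Average cost of a threshold policy *)

Section ThresholdPolicy.
Variables (R : realType) (p C : R) (X : nat).

(** At [h = [::]] and [n = T.+1] this is [expected_total_cost]; the past is a parameter so that the
    process can restart after one slot. *)
Definition expected_cost (mu : policy R) n h s : R :=
  \sum_(w : n.-tuple (action * bool)%type)
    trajectory_prob p mu h s w * trajectory_cost C s w.

Lemma expected_costS (mu : policy R) n h s :
  expected_cost mu n.+1 h s = \sum_(a : bool) bernoulli_pmf (mu h s) a *
    (cost C s a + \sum_(l : bool) bernoulli_pmf p l *
       expected_cost mu n (rcons h (s, a)) (next_age s a, l)).
Proof.
rewrite /expected_cost
  (big_tupleS (fun w => trajectory_prob p mu h s w * trajectory_cost C s w)).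
rewrite (eq_bigr (fun al : action * bool =>
    bernoulli_pmf (mu h s) al.1 * (bernoulli_pmf p al.2 * (cost C s al.1 +
      expected_cost mu n (rcons h (s, al.1)) (next_age s al.1, al.2))))); last first.
  (* The weights of the remaining records sum to 1, so the cost of the first slot can move inside
     the sum. *)
  case=> a l _ /=; have -> :
      cost C s a + expected_cost mu n (rcons h (s, a)) (next_age s a, l) =
      \sum_(w : n.-tuple (action * bool)%type)
        trajectory_prob p mu (rcons h (s, a)) (next_age s a, l) w *
        (cost C s a + trajectory_cost C (next_age s a, l) w).
    under [RHS]eq_bigr do rewrite mulrDr.
    by rewrite big_split /= -mulr_suml trajectory_prob_sum mul1r.
  by rewrite !mulr_sumr; apply: eq_bigr => w _; rewrite !mulrA.
rewrite -(pair_big xpredT xpredT (fun a l : bool =>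
    bernoulli_pmf (mu h s) a * (bernoulli_pmf p l * (cost C s a +
      expected_cost mu n (rcons h (s, a)) (next_age s a, l))))) /=.
by rewrite !big_bool /= /expected_cost; ring.
Qed.

(* The one-slot operator of the threshold policy, on functions of the age alone:
   the arrival indicator of the current slot is averaged out. *)
Definition threshold_step (f : nat -> R) (x : nat) : R :=
  if (X <= x)%N then (1 - p) * (x%:R + 1 + f x.+1) + p * (1 + C + f 1%N)
  else x%:R + 1 + f x.+1.

Definition mean_cost n : nat -> R := iter n threshold_step (fun=> 0).

Lemma expected_cost_thresholdS n h s :
  expected_cost (threshold_policy R X) n.+1 h s =
  let a := s.2 && (X <= s.1)%N in
  cost C s a + \sum_(l : bool) bernoulli_pmf p l *
    expected_cost (threshold_policy R X) n (rcons h (s, a)) (next_age s a, l).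
Proof.
rewrite expected_costS bernoulli_pmf_sum /= /threshold_update_prob.
by case: (_ && _); rewrite ?subrr ?subr0 !mul0r mul1r ?addr0 ?add0r.
Qed.

(** The next arrival is independent of the next age, so averaging over it closes the recursion on
    the age alone. *)
Lemma expected_cost_threshold n h h' x :
  p * expected_cost (threshold_policy R X) n h (x, true) +
  (1 - p) * expected_cost (threshold_policy R X) n h' (x, false) = mean_cost n x.
Proof.
elim: n h h' x => [|n IHn] h h' x.
  rewrite /expected_cost /mean_cost /=.
  by rewrite !big1 ?mulr0 ?addr0 // => w _; rewrite [w]tuple0 /= mulr0.
rewrite -[RHS]/(threshold_step (mean_cost n) x) /threshold_step.
rewrite !expected_cost_thresholdS /= !bernoulli_pmf_sum !IHn /cost /next_age /=.
by case: leqP => _ /=; ring.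
Qed.

Definition mean_cycle (Y : nat) : R := Y%:R - 1 + p^-1.

Definition threshold_average : R :=
  (mean_cycle X + 1) / 2 + (C + (1 - p) / (2 * p ^+ 2)) / mean_cycle X.

Local Notation g := threshold_average.

(* Solution of the Poisson equation, normalized to vanish at age 1. *)
Definition relative_value (x : nat) : R :=
  let q y := g * (y%:R - 1) - (y%:R * (y%:R + 1) / 2 - 1) in
  if (x < X)%N then q x else q X + (1 - p) / p * (x%:R - X%:R).

Hypotheses (hp0 : 0 < p) (hp1 : p <= 1) (hX : (0 < X)%N).

Lemma mean_cycle_gt0 Y : (0 < Y)%N -> 0 < mean_cycle Y.
Proof.
move=> Y0; rewrite /mean_cycle; have : 0 < p^-1 by rewrite invr_gt0.
have : 1 <= Y%:R :> R by rewrite ler1n.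
lra.
Qed.

(** Below [X] the equation prescribes the increments [g - (x + 1)], which sum to [q]; from [X] on
    the terms in [x] force the slope [(1 - p) / p], and the constant terms determine [g]. *)
Lemma relative_value_poisson x :
  g + relative_value x = threshold_step relative_value x.
Proof.
have H1 : relative_value 1 = 0.
  rewrite /relative_value; case: ltnP => hX1.
    by field.
  have -> : X = 1%N by apply/eqP; rewrite eqn_leq hX1 hX.
  by rewrite !subrr !mulr0 add0r addr0; field.
have p0 : p != 0 by rewrite gt_eqF.
have u0 : mean_cycle X != 0 by rewrite gt_eqF ?mean_cycle_gt0.
rewrite /threshold_step H1 /relative_value; case: leqP => hx.
  rewrite ltnNge (leq_trans hx (leqnSn _)) /= /threshold_average.
  move: u0; rewrite /mean_cycle -(natr1 x) => u0.
  have u1 : (X%:R - 1) * p + 1 != 0.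
    have -> : (X%:R - 1) * p + 1 = (X%:R - 1 + p^-1) * p by field.
    by rewrite mulf_neq0.
  by field; rewrite p0 u1.
have [hx1|hx1] := ltnP x.+1 X; first by rewrite -(natr1 x); field.
(* Last age before the threshold: at [X] the affine branch starts from [q X]. *)
have -> : X = x.+1 by apply/eqP; rewrite eqn_leq hx1 hx.
by rewrite -(natr1 x); field.
Qed.

(** The function is affine from [X] on, and [B] absorbs the finitely many earlier values. *)
Lemma relative_value_bound :
  exists A B : R, [/\ 0 <= A, 0 <= B & forall x, `|relative_value x| <= A * x%:R + B].
Proof.
set a := (1 - p) / p; set b := relative_value X - a * X%:R.
exists `|a|, (`|b| + \sum_(y < X) `|relative_value y|).
have S0 : 0 <= \sum_(y < X) `|relative_value y| by exact: sumr_ge0.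
split => [//||x]; first exact: addr_ge0.
have [hx|hx] := ltnP x X.
  have : `|relative_value x| <= \sum_(y < X) `|relative_value y|.
    by rewrite (bigD1 (Ordinal hx)) //= lerDl sumr_ge0.
  have : 0 <= `|a| * x%:R by exact: mulr_ge0.
  have : 0 <= `|b| by [].
  lra.
have -> : relative_value x = a * x%:R + b.
  by rewrite /b /relative_value ltnn ltnNge hx /= -/a; ring.
have -> : `|a| * x%:R = `|a * x%:R| by rewrite [RHS]normrM normr_nat.
by have := ler_normD (a * x%:R) b; lra.
Qed.

(* The age has drift factor [1 - p] towards [0], so its mean stays bounded. *)
Lemma mean_cost_approx (A B : R) n x : 0 <= A ->
  (forall y, `|relative_value y| <= A * y%:R + B) ->
  `|mean_cost n x - (n%:R * g + relative_value x)| <=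
  A * (1 - p) ^+ n * x%:R + A * X%:R / p * (1 - (1 - p) ^+ n) + B.
Proof.
move=> A0 HAB; elim: n x => [|n IHn] x.
  rewrite /mean_cost /= mul0r !add0r normrN expr0 subrr !mulr0 mulr1 addr0.
  exact: HAB.
have p0 : p != 0 by rewrite gt_eqF.
have r0 : 0 <= (1 - p) ^+ n by rewrite exprn_ge0 // subr_ge0.
(* The middle term of the bound is the sum of [A * X%:R * (1 - p) ^+ k] over [k < n]; one more slot
   adds the term of index [n]. *)
have step : A * X%:R / p * (1 - (1 - p) ^+ n.+1) =
    A * X%:R / p * (1 - (1 - p) ^+ n) + A * X%:R * (1 - p) ^+ n.
  by rewrite exprS; field.
have -> : n.+1%:R * g + relative_value x = n%:R * g + threshold_step relative_value x.
  by rewrite -relative_value_poisson -natr1; ring.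
rewrite -[mean_cost n.+1 x]/(threshold_step (mean_cost n) x) step exprS.
set r := (1 - p) ^+ n in r0 IHn *.
set Q := A * X%:R / p * (1 - r) in IHn *.
have Ar0 : 0 <= A * r by exact: mulr_ge0.
have := IHn x.+1; have := IHn 1%N.
rewrite /threshold_step; case: leqP => hx.
  set e1 := mean_cost n 1 - _; set e2 := mean_cost n x.+1 - _ => he1 he2.
  set E := _ - _.
  have -> : E = (1 - p) * e2 + p * e1 by rewrite /E /e1 /e2; ring.
  have := ler_normD ((1 - p) * e2) (p * e1).
  rewrite !normrM (ger0_norm (ltW hp0)) ger0_norm ?subr_ge0 // => h.
  have h1 : p * `|e1| <= p * (A * r * 1 + Q + B) by rewrite ler_pM2l.
  have h2 : (1 - p) * `|e2| <= (1 - p) * (A * r * x.+1%:R + Q + B).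
    by rewrite ler_wpM2l // subr_ge0.
  (* Ages [x.+1] and [1] together exceed [A * ((1 - p) * r) * x%:R] by [A * r], which the added term
     covers as [X] is positive. *)
  have h3 : A * r <= A * r * X%:R by rewrite ler_peMr // ler1n.
  by move: h h1 h2 h3; rewrite -natr1; nra.
move=> _ he2; set E := _ - _.
have -> : E = mean_cost n x.+1 - (n%:R * g + relative_value x.+1) by rewrite /E; ring.
(* Nothing contracts below the threshold, but there [x.+1 <= X], so the added term covers the whole
   age term. *)
have h3 : A * r * x.+1%:R <= A * r * X%:R by rewrite ler_wpM2l // ler_nat.
have : 0 <= A * ((1 - p) * r) * x%:R by rewrite !mulr_ge0 // subr_ge0.
by move: he2 h3; lra.
Qed.

Lemma average_cost_threshold s0 :
  average_cost p C (threshold_policy R X) s0 = g%:E.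
Proof.
have [A [B [A0 B0 HAB]]] := relative_value_bound.
set a := s0.2 && (X <= s0.1)%N; set y := next_age s0 a.
have totalE T : expected_total_cost p C (threshold_policy R X) s0 T =
    cost C s0 a + mean_cost T y.
  rewrite -[LHS]/(expected_cost (threshold_policy R X) T.+1 [::] s0).
  by rewrite expected_cost_thresholdS /= bernoulli_pmf_sum expected_cost_threshold.
(* [mean_cost] covers only [T] of the [T.+1] slots, hence the [- g]; the rest bounds the error
   uniformly in [T], as [(1 - p) ^+ T] lies in [0, 1]. *)
pose M : R := `|cost C s0 a + relative_value y - g| + (A * y%:R + A * X%:R / p + B).
have bound T : `|expected_total_cost p C (threshold_policy R X) s0 T - T.+1%:R * g| <= M.
  rewrite totalE; have := mean_cost_approx T y A0 HAB.
  set e := mean_cost T y - _ => he.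
  have -> : cost C s0 a + mean_cost T y - T.+1%:R * g =
      (cost C s0 a + relative_value y - g) + e by rewrite /e -natr1; ring.
  apply: (le_trans (ler_normD _ _)); rewrite lerD2l (le_trans he) //.
  have r0 : 0 <= (1 - p) ^+ T by rewrite exprn_ge0 // subr_ge0.
  have r1 : (1 - p) ^+ T <= 1 by rewrite exprn_ile1 ?subr_ge0 // gerBl ltW.
  have Q0 : 0 <= A * X%:R / p by rewrite divr_ge0 ?mulr_ge0 // ltW.
  rewrite lerD2r lerD //.
    by rewrite ler_wpM2r // ler_piMr.
  by rewrite ler_piMr // gerBl.
rewrite /average_cost; set v := (v in limn_esup v).
suff h : (v @ \oo --> g%:E)%classic by rewrite (cvg_limn_einf_sup h).2.
apply: cvg_EFin; first by near=> T.
have hM : (M * harmonic T @[T --> \oo] --> 0)%classic.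
  rewrite -[v in (_ --> v)%classic](mulr0 M); apply: cvgM; first exact: cvg_cst.
  exact: cvg_harmonic.
apply: (@squeeze_cvgr _ _ _ _ (fun T => g - M * harmonic T)
  (fun T => g + M * harmonic T)).
- near=> T; rewrite -ler_distlC distrC /=.
  have -> : T.+1%:R^-1 * expected_total_cost p C (threshold_policy R X) s0 T - g =
    (expected_total_cost p C (threshold_policy R X) s0 T - T.+1%:R * g) / T.+1%:R.
    by field.
  by rewrite normrM [X in _ * X]ger0_norm ?invr_ge0 // ler_pM2r ?invr_gt0.
- rewrite -[v in (_ --> v)%classic]subr0; apply: cvgB => //; exact: cvg_cst.
- rewrite -[v in (_ --> v)%classic]addr0; apply: cvgD => //; exact: cvg_cst.
Unshelve. all: by end_near.
Qed.

End ThresholdPolicy.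

(** * Comparison of thresholds and the optimal one *)

Section OptimalThreshold.
Variables (R : realType) (p : R).
Hypotheses (hp0 : 0 < p) (hp1 : p <= 1).

Local Notation u := (mean_cycle p).
Local Notation K C := (2 * C + (1 - p) / p ^+ 2).

(** Up to a constant the average is half of [u X + K C / u X], and [Y - X = u Y - u X]. *)
Lemma threshold_averageB (C : R) X Y : (0 < X)%N -> (0 < Y)%N ->
  threshold_average p C Y - threshold_average p C X =
  (Y%:R - X%:R) * (u X * u Y - K C) / (2 * (u X * u Y)).
Proof.
move=> X0 Y0; have uX := mean_cycle_gt0 hp0 X0; have uY := mean_cycle_gt0 hp0 Y0.
have -> : Y%:R - X%:R = u Y - u X by rewrite /mean_cycle; ring.
rewrite /threshold_average.
by field; rewrite !gt_eqF.
Qed.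

Lemma threshold_average_le (C : R) X Y : (0 < X)%N -> (X < Y)%N ->
  (threshold_average p C X <= threshold_average p C Y) = (K C <= u X * u Y).
Proof.
move=> X0 XY; have Y0 := leq_ltn_trans (leq0n _) XY.
have uX := mean_cycle_gt0 hp0 X0; have uY := mean_cycle_gt0 hp0 Y0.
rewrite -subr_ge0 threshold_averageB // pmulr_lge0 ?invr_gt0 ?mulr_gt0 //.
by rewrite pmulr_rge0 ?subr_ge0 // subr_gt0 ltr_nat.
Qed.

Lemma threshold_average_ge (C : R) X Y : (0 < X)%N -> (X < Y)%N ->
  (threshold_average p C Y <= threshold_average p C X) = (u X * u Y <= K C).
Proof.
move=> X0 XY; have Y0 := leq_ltn_trans (leq0n _) XY.
have uX := mean_cycle_gt0 hp0 X0; have uY := mean_cycle_gt0 hp0 Y0.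
rewrite -subr_le0 threshold_averageB // pmulr_lle0 ?invr_gt0 ?mulr_gt0 //.
by rewrite pmulr_rle0 ?subr_le0 // subr_gt0 ltr_nat.
Qed.

Lemma mean_cycle_le X Y : (X <= Y)%N -> u X <= u Y.
Proof. by move=> XY; rewrite !lerD2r ler_nat. Qed.

Lemma mean_cycleM_le X Y X' Y' : (0 < X)%N -> (0 < Y)%N ->
  (X <= X')%N -> (Y <= Y')%N -> u X * u Y <= u X' * u Y'.
Proof.
by move=> X0 Y0 XX' YY'; apply: ler_pM; rewrite ?mean_cycle_le // ltW ?mean_cycle_gt0.
Qed.

Lemma mean_cycleM_unbounded (c : R) :
  exists X, (0 < X)%N && (c < u X * u X.+1).
Proof.
(* With [t] the truncation plus one, both factors are at least [t + 1], so the product exceeds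
   [t > c]. *)
exists (Num.truncn `|c|).+2 => /=.
have hc : c < (Num.truncn `|c|).+1%:R.
  exact: le_lt_trans (ler_norm c) (truncnS_gt _).
have i1 : 1 <= p^-1 by rewrite invf_ge1.
rewrite /mean_cycle -2!(natr1 _.+1).
have : 0 <= (Num.truncn `|c|).+1%:R :> R by [].
set t := (Num.truncn `|c|).+1%:R in hc *.
nra.
Qed.

(** Since [u] is increasing, comparing neighbours settles all comparisons: smaller thresholds are no
    better than [X], larger ones strictly worse, which also resolves ties. *)
Lemma is_optimal_threshold_least (C : R) s0 X :
  (0 < X)%N -> K C < u X * u X.+1 ->
  (forall Y, (0 < Y)%N -> (Y < X)%N -> u Y * u Y.+1 <= K C) ->
  is_optimal_threshold p C s0 X.
Proof.
move=> X0 hX least.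
have minP Y : (0 < Y)%N -> (Y < X)%N -> u Y * u X <= K C.
  move=> Y0 YX; have X1 : (0 < X.-1)%N by rewrite -ltnS prednK // (leq_ltn_trans Y0).
  apply: le_trans (least _ X1 _); last by rewrite prednK.
  by rewrite prednK // mean_cycleM_le // -ltnS prednK.
have gtP Y : (X < Y)%N -> K C < u X * u Y.
  by move=> XY; apply: lt_le_trans hX _; rewrite mean_cycleM_le.
split=> [|Y [Y0 /(_ X X0)]].
  split=> // Y Y0; rewrite !average_cost_threshold // lee_fin.
  have [YX|XY|->//] := ltngtP Y X.
    by rewrite threshold_average_ge // minP.
  by rewrite threshold_average_le // ltW // gtP.
rewrite !average_cost_threshold // lee_fin; apply: contraTleq => XY.
by rewrite threshold_average_ge // -ltNge gtP.
Qed.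

Lemma optimal_thresholdE (C : R) s0 x : (0 < x)%N ->
  (optimal_threshold p C s0 <= x)%N = (K C < u x * u x.+1).
Proof.
move=> x0; case: (ex_minnP (mean_cycleM_unbounded (K C))) => X /andP[X0 hX] least.
have optX : is_optimal_threshold p C s0 X.
  apply: is_optimal_threshold_least => // Y Y0 YX.
  by rewrite leNgt; apply: contraTN YX => hY; rewrite -leqNgt least // Y0.
(* The largest minimizer is unique, so [xget] returns it and never its default. *)
have -> : optimal_threshold p C s0 = X.
  apply: xget_unique => // Y [minY maxY].
  by apply/eqP; rewrite eqn_leq (optX.2 _ minY) (maxY _ optX.1).
apply/idP/idP => [Xx|hx]; last by rewrite least // x0.
by apply: lt_le_trans hX _; rewrite mean_cycleM_le.
Qed.

(** Indexability becomes a matter of two inequalities in [C]; without an arrival the immediate costs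
    differ by exactly [C]. *)
Lemma idle_setE (C : R) s0 x l :
  idle_set p s0 C (x, l) <->
  (0 < x)%N /\ (if l then u x * u x.+1 <= K C else 0 <= C).
Proof.
rewrite /idle_set /optimal_action /state_space /=; case: l => /=.
  split=> -[x0]; rewrite optimal_thresholdE // leNgt; first by case: ifP.
  by move=> /negbTE ->.
have -> : (cost C (x, false) update < cost C (x, false) idle) = (C < 0).
  by rewrite /cost /= !mulr0 !mulr1 addr0 subr0 gtrDl.
by split=> -[x0]; rewrite leNgt; case: (C < 0).
Qed.

End OptimalThreshold.

Theorem theorem10 (R : realType) (p : R) (hp0 : 0 < p) (hp1 : p <= 1)
    (s0 : state) (hs0 : state_space s0) :
  indexable (idle_set p s0).
Proof.
split=> [C D CD [x l]|//|].
- move=> /(idle_setE hp0 hp1)[x0 h]; apply/(idle_setE hp0 hp1); split=> //.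
  by case: l h; lra.
- apply/seteqP; split=> // -[x l] h.
  set K := (1 - p) / p ^+ 2.
  have /(idle_setE hp0 hp1)[x0 _] := h 0 I.
  (* At this cost both [C] and [2 * C + K] are negative, so idling is optimal nowhere. *)
  have /(idle_setE hp0 hp1)[_] := h (- 1 - `|K|) I.
  have uu0 : 0 < mean_cycle p x * mean_cycle p x.+1.
    by rewrite mulr_gt0 // mean_cycle_gt0.
  have := ler_norm K; have := normr_ge0 K; rewrite -/K.
  by case: l h => _; lra.
- apply/seteqP; split=> [s [C _ [s0' _]] //|[x l] x0].
  set m := mean_cycle p x * mean_cycle p x.+1.
  (* This cost is nonnegative and at least [m], which meets both idling conditions. *)
  exists `|m| => //; apply/(idle_setE hp0 hp1); split=> //; case: l x0 => // x0.
  have : 0 <= (1 - p) / p ^+ 2 by rewrite divr_ge0 ?subr_ge0 ?exprn_ge0 // ltW.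
  by have := ler_norm m; have := normr_ge0 m; rewrite -/m; lra.
Qed.
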